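(* Let $r\in(0,1/2)$ and consider the asynchronous space-time-coded scheme described in the context. Assume the waveform $s$ is supported in $[0,2T_s]$, the relative delay is $\tau\in(0,T_s)$, and the linear-independence condition holds with $M=2$. Then $$d_{A\text{-}stc}(r):=\lim_{\mathrm{SNR}\to\infty}-\frac{\log\Pr[I_{A\text{-}stc}<R(\mathrm{SNR})]}{\log\mathrm{SNR}}=3(1-2r),$$ which is the same as the tradeoff of the synchronous space-time-coded scheme.
   Context: Network: a source $N_S$, two relays $N_{R_1},N_{R_2}$ and a destination $N_D$. The gains $\alpha_{i,j}$, $i\in\{S,R_1,R_2\}$, $j\in\{R_1,R_2,D\}$, $i\neq j$, are mutually independent zero-mean circularly symmetric complex Gaussian random variables with variances $\sigma^2_{i,j}>0$. For $\mathrm{SNR}>0$ set $\rho_0=\frac23\mathrm{SNR}$. The target rate is $R=R(\mathrm{SNR})=r\log_2(1+\mathrm{SNR}\,\sigma^2_{S,D})$ and all mutual informations are in bits. Relay $R_k$ belongs to the decoding set $\mathcal D(s)$ iff $\frac12\log_2(1+\rho_0|\alpha_{S,R_k}|^2)\ge R$. Waveform: $s$ is real-valued with $s(t)=0$ for $t\notin[0,MT_s]$ and $\int s^2=1$. Fix $\tau\in(0,T_s)$. - Let $S(t)=[s(t),s(t-\tau)]^T$, $G(k)=\int S(t)S(t-kT_s)^Tdt$, and $\tilde T(\omega)=\sum_{k\in\mathbb Z}G(k)e^{-jk\omega}$, with entries $\tilde T_{11}(\omega),\dots$. Note $\tilde T_{11}=\tilde T_{22}$. - Linear-independence condition: for every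 $\omega\in[-\pi,\pi]$, the functions $F_1(t,\omega)=\sum_{k=0}^M s(t+kT_s)e^{jk\omega}$ and $F_2(t,\omega)=\sum_{k=0}^M s(t-\tau+kT_s)e^{jk\omega}$ are linearly independent over $\mathbb C$ on $t\in[0,T_s]$. Mutual informations: - For a gain $\alpha$, $I_{E\text{-}SD}(\alpha)=\frac1{2\pi}\int_{-\pi}^{\pi}\log_2\left(1+\rho_0|\alpha|^2\tilde T_{11}(\omega)\right)d\omega$. - With $\alpha_1=\alpha_{R_1,D}$ and $\alpha_2=\alpha_{R_2,D}$, $$I_{E\text{-}MacA}=\frac1{2\pi}\int_{-\pi}^{\pi}\log_2\left(1+\rho_0(|\alpha_1|^2+|\alpha_2|^2)\tilde T_{11}(\omega)+\rho_0^2|\alpha_1|^2|\alpha_2|^2\det\tilde T(\omega)\right)d\omega.$$ The end-to-end mutual information $I_{A\text{-}stc}$ is: - $\frac12I_{E\text{-}SD}(\alpha_{S,D})$ if $\mathcal D(s)=\emptyset$; - $\frac12I_{E\text{-}SD}(\alpha_{S,D})+\frac12I_{E\text{-}SD}(\alpha_{R_j,D})$ if $\mathcal D(s)=\{R_j\}$; - $\frac12I_{E\text{-}SD}(\alpha_{S,D})+\frac12I_{E\text{-}MacA}$ if $|\mathcal D(s)|=2$. The probability $\Pr[I_{A\text{-}stc}<R]$ averages over the gains, including the randomness of $\mathcal D(s)$. *)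

(* Defs.v *)
From HB Require Import structures.
From mathcomp Require Import all_boot all_order all_algebra.
From mathcomp Require Import all_classical all_reals all_analysis.
From mathcomp Require Import complex.
Set Implicit Arguments.
Unset Strict Implicit.
Unset Printing Implicit Defensive.
Import Order.TTheory GRing.Theory Num.Theory.
Import numFieldTopology.Exports.
Local Open Scope classical_set_scope.
Local Open Scope ring_scope.

(* Links of the network N_S, N_R1, N_R2, N_D: all ordered pairs (i,j), *)
(* i in {S,R1,R2}, j in {R1,R2,D}, i <> j  (7 links).                 *)
Definition link := 'I_7.
Definition lSR1 : link := @Ordinal 7 0 isT.
Definition lSR2 : link := @Ordinal 7 1 isT.
Definition lSD  : link := @Ordinal 7 2 isT.
Definition lR1R2 : link := @Ordinal 7 3 isT.
Definition lR1D : link := @Ordinal 7 4 isT.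
Definition lR2R1 : link := @Ordinal 7 5 isT.
Definition lR2D : link := @Ordinal 7 6 isT.

Section Model.
Variable R : realType.

Definition log2 (x : R) : R := ln x / ln 2.

(* Fading gains: alpha_l = re l + j im l is a zero-mean circularly     *)
(* symmetric complex Gaussian of variance sigma2 l, i.e. re l, im l    *)
(* are i.i.d. N(0, sigma2 l / 2); all gains mutually independent,     *)
(* i.e. the 14 real components are mutually independent.             *)
Definition cscg_independent_gains (d : measure_display) (T : measurableType d)
    (P : probability T R) (re im : link -> T -> R) (sigma2 : link -> R) : Prop :=
  [/\ (forall l, measurable_fun setT (re l)),
      (forall l, measurable_fun setT (im l)),
      (forall l (A : set R), measurable A ->
          P (re l @^-1` A) = normal_prob 0 (Num.sqrt (sigma2 l / 2)) A),
      (forall l (A : set R), measurable A ->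
          P (im l @^-1` A) = normal_prob 0 (Num.sqrt (sigma2 l / 2)) A) &
      (forall (A B : link -> set R),
          (forall l, measurable (A l)) -> (forall l, measurable (B l)) ->
          P (\bigcap_l (re l @^-1` A l `&` im l @^-1` B l)) =
          (\prod_(l : link) (P (re l @^-1` A l) * P (im l @^-1` B l)))%E)].

Definition gain2 (T : Type) (re im : link -> T -> R) (l : link) (w : T) : R :=
  re l w ^+ 2 + im l w ^+ 2.

Local Open Scope complex_scope.

Definition Svec (s : R -> R) (tau : R) (a : 'I_2) (t : R) : R :=
  if val a == 0%N then s t else s (t - tau).

Definition Gram (s : R -> R) (tau Ts : R) (k : int) (a b : 'I_2) : R :=
  Rintegral lebesgue_measure setT
    (fun t => Svec s tau a t * Svec s tau b (t - k%:~R * Ts)).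

Definition expmj (k : int) (w : R) : R[i] := cos (k%:~R * w) -i* sin (k%:~R * w).
Definition expj (k : int) (w : R) : R[i] := cos (k%:~R * w) +i* sin (k%:~R * w).

Definition Ttilde_partial (s : R -> R) (tau Ts : R) (a b : 'I_2) (w : R) (n : nat)
  : R[i] :=
  \sum_(i < n.*2.+1)
     ((Gram s tau Ts (i%:Z - n%:Z) a b)%:C * expmj (i%:Z - n%:Z) w).

(* \tilde T_{ab}(w) = \sum_{k in Z} G_{ab}(k) e^{-jkw}  (bilateral series,
   limit of symmetric partial sums, taken componentwise in C) *)
Definition Ttilde (s : R -> R) (tau Ts : R) (a b : 'I_2) (w : R) : R[i] :=
  (limn (fun n => complex.Re (Ttilde_partial s tau Ts a b w n)))
  +i* (limn (fun n => complex.Im (Ttilde_partial s tau Ts a b w n))).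

Definition i0 : 'I_2 := ord0.
Definition i1 : 'I_2 := ord_max.

Definition Ttilde11 s tau Ts w := Ttilde s tau Ts i0 i0 w.
Definition detTtilde s tau Ts w : R[i] :=
  Ttilde s tau Ts i0 i0 w * Ttilde s tau Ts i1 i1 w
  - Ttilde s tau Ts i0 i1 w * Ttilde s tau Ts i1 i0 w.

Definition F1 (s : R -> R) (Ts : R) (M : nat) (t w : R) : R[i] :=
  \sum_(k < M.+1) ((s (t + k%:R * Ts))%:C * expj k w).
Definition F2 (s : R -> R) (tau Ts : R) (M : nat) (t w : R) : R[i] :=
  \sum_(k < M.+1) ((s (t - tau + k%:R * Ts))%:C * expj k w).

Definition lin_indep_condition (s : R -> R) (tau Ts : R) (M : nat) : Prop :=
  forall w : R, w \in `[- pi, pi] ->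
  forall c1 c2 : R[i],
    {ae lebesgue_measure, forall t : R, t \in `[0, Ts] ->
        c1 * F1 s Ts M t w + c2 * F2 s tau Ts M t w = 0} ->
    c1 = 0 /\ c2 = 0.

Definition waveform (s : R -> R) (Ts : R) (M : nat) : Prop :=
  [/\ measurable_fun setT s,
      (forall t, t \notin `[0, M%:R * Ts] -> s t = 0),
      lebesgue_measure.-integrable setT (fun t => (s t ^+ 2)%:E) &
      Rintegral lebesgue_measure setT (fun t => s t ^+ 2) = 1].

(* Mutual informations (bits); g, g1, g2 are squared gain moduli.     *)
Definition rho0 (snr : R) : R := 2 / 3 * snr.

Definition I_ESD (s : R -> R) (tau Ts snr g : R) : R :=
  (2 * pi)^-1 * Rintegral lebesgue_measure `[- pi, pi]
    (fun w => log2 (1 + rho0 snr * g * complex.Re (Ttilde11 s tau Ts w))).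

Definition I_EMacA (s : R -> R) (tau Ts snr g1 g2 : R) : R :=
  (2 * pi)^-1 * Rintegral lebesgue_measure `[- pi, pi]
    (fun w => log2 (complex.Re
       (1 + (rho0 snr * (g1 + g2))%:C * Ttilde11 s tau Ts w
          + (rho0 snr ^+ 2 * g1 * g2)%:C * detTtilde s tau Ts w))).

Definition rate (r snr sigma2SD : R) : R := r * log2 (1 + snr * sigma2SD).

Definition decodes (snr Rt g : R) : bool := 2^-1 * log2 (1 + rho0 snr * g) >= Rt.

Definition I_Astc (T : Type) (re im : link -> T -> R) (s : R -> R)
    (tau Ts snr Rt : R) (w : T) : R :=
  let g := gain2 re im in
  let d1 := decodes snr Rt (g lSR1 w) in
  let d2 := decodes snr Rt (g lSR2 w) in
  let ISD := 2^-1 * I_ESD s tau Ts snr (g lSD w) in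
  if d1 && d2 then ISD + 2^-1 * I_EMacA s tau Ts snr (g lR1D w) (g lR2D w)
  else if d1 then ISD + 2^-1 * I_ESD s tau Ts snr (g lR1D w)
  else if d2 then ISD + 2^-1 * I_ESD s tau Ts snr (g lR2D w)
  else ISD.

Definition outage (d : measure_display) (T : measurableType d) (P : probability T R)
    (re im : link -> T -> R) (sigma2 : link -> R) (s : R -> R) (tau Ts r snr : R)
  : R :=
  let Rt := rate r snr (sigma2 lSD) in
  fine (P [set w | I_Astc re im s tau Ts snr Rt w < Rt]).

End Model.

(* Main.v *)
Require Import Defs.
From HB Require Import structures.
From mathcomp Require Import all_boot all_order all_algebra.
From mathcomp Require Import all_classical all_reals all_analysis.
From mathcomp Require Import measurable_realfun complex ring lra zify.
Import Order.TTheory GRing.Theory Num.Theory.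
Import numFieldTopology.Exports.
Local Open Scope classical_set_scope.
Local Open Scope ring_scope.

(* Let [u_0 = s] and [u_1 = s (. - tau)].  Cutting [u_a] into slots of length [Ts]
   shows that [Ttilde(w)] is the Gram matrix of [F1(., w)] and [F2(., w)] in
   L^2([0, Ts[), so linear independence makes it positive definite; being a
   trigonometric polynomial in [w], it is uniformly so on the compact interval
   [-pi, pi].  Hence, up to constants, [I_ESD(g)] is [log2 (1 + rho g)] and
   [I_EMacA(g1, g2)] is at least [log2 (1 + rho g1) + log2 (1 + rho g2)].  With
   [K = 2^(2 Rt)], whatever the decoding set is, an outage forces three independent
   squared gains below a multiple of [K / rho], an event of probability
   O((K / rho)^3); conversely if the gains of S-R1, S-R2 and S-D are below a small
   multiple of [K / rho] then no relay decodes and there is an outage.  As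
   [K / rho] is of order [SNR^(2r - 1)], the exponent is [3 (1 - 2r)]. *)

(** * Square-integrable functions on the line *)

Section lebesgue_shift.
Context {R : realType}.
Local Notation mu := (@lebesgue_measure R).

Lemma measurable_shift (c : R) : measurable_fun setT (fun x : R => x + c).
Proof. exact: measurable_funD. Qed.

(** Uniqueness of Lebesgue measure reduces the claim to half-open intervals, whose length a
    translation preserves. *)
Lemma lebesgue_measure_shift (c : R) (A : set R) : measurable A ->
  pushforward mu ((fun x => x + c) : _ -> measurableTypeR R) A = mu A.
Proof.
move=> mA; apply/esym/lebesgue_measure_unique => //=.
  exact: measurable_shift.
move=> ? _ [[a b]] _ <-.
rewrite /pushforward/= (_ : _ @^-1` _ = `]a - c, b - c]%classic); last first.
  by apply/seteqP; split => x /=; rewrite !in_itv/= ltrBlDr lerBrDr.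
rewrite !lebesgue_measure_itv/= !lte_fin ltrD2r.
by case: ifPn => // _; rewrite -!EFinD; congr (_%:E); lra.
Qed.

Lemma ge0_integral_shift (c : R) (f : R -> \bar R) :
  measurable_fun setT f -> (forall x, 0 <= f x)%E ->
  (\int[mu]_x f (x + c)%R = \int[mu]_x f x)%E.
Proof.
move=> mf f0.
rewrite -[in LHS](preimage_setT ((fun x => x + c) : _ -> measurableTypeR R)).
have mc : @measurable_fun _ _ (measurableTypeR R) (measurableTypeR R) setT
  (fun x => x + c) by exact: measurable_shift.
rewrite -(@ge0_integral_pushforward _ _ _ (measurableTypeR R) _ _ mc _ setT f)//=.
by apply: eq_measure_integral => A mA _; exact: lebesgue_measure_shift.
Qed.

Lemma integral_shift (c : R) (f : R -> \bar R) : measurable_fun setT f ->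
  (\int[mu]_x f (x + c)%R = \int[mu]_x f x)%E.
Proof.
move=> mf; rewrite [RHS]integralE [LHS]integralE.
have := ge0_integral_shift c (f^\+)%E (measurable_funepos mf) (funepos_ge0 f).
have := ge0_integral_shift c (f^\-)%E (measurable_funeneg mf) (funeneg_ge0 f).
by move=> <- <-; congr (_ - _)%E; apply: eq_integral => x _;
  rewrite ?funeposE ?funenegE.
Qed.

Lemma integrable_shift (c : R) (f : R -> R) :
  mu.-integrable setT (EFin \o f) ->
  mu.-integrable setT (EFin \o (fun x => f (x + c))).
Proof.
move=> /integrableP[mf foo]; apply/integrableP; split.
  by apply: (measurableT_comp mf); exact: measurable_shift.
by rewrite (integral_shift c (fun x => `|(f x)%:E|%E))//; exact: measurableT_comp.
Qed.

Lemma Rintegral_shift (c : R) (f : R -> R) : measurable_fun setT f ->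
  \int[mu]_x f (x + c) = \int[mu]_x f x.
Proof.
move=> mf; congr fine; apply: (integral_shift c (EFin \o f)).
exact/measurable_EFinP.
Qed.

End lebesgue_shift.

Section square_integrable.
Context {R : realType}.
Local Notation mu := (@lebesgue_measure R).
Implicit Types f g h : R -> R.

Definition square_integrable f :=
  measurable_fun setT f /\ mu.-integrable setT (EFin \o (fun t => f t ^+ 2)%R).

Definition inner f g : R := \int[mu]_t (f t * g t).

(** The product is dominated by [f ^+ 2 + g ^+ 2]. *)
Lemma integrable_inner f g : square_integrable f -> square_integrable g ->
  mu.-integrable setT (EFin \o (fun t => f t * g t)).
Proof.
move=> [mf f2] [mg g2].
have fg : mu.-integrable setT (EFin \o (fun t => f t ^+ 2 + g t ^+ 2)).
  rewrite (_ : EFin \o _ = ((EFin \o (fun t => f t ^+ 2)%R) \+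
    (EFin \o (fun t => g t ^+ 2)%R))%E); first by apply: integrableD.
  by apply/funext => t/=; rewrite EFinD.
apply: le_integrable fg => //.
  by apply/measurable_EFinP; exact: measurable_funM.
move=> t _ /=; rewrite lee_fin normrM [leRHS]ger0_norm ?addr_ge0 ?sqr_ge0//.
rewrite -(real_normK (num_real (f t))) -(real_normK (num_real (g t))).
have := normr_ge0 (f t); have := normr_ge0 (g t); nra.
Qed.

Lemma square_integrable0 : square_integrable (fun=> 0).
Proof.
split=> //; rewrite (_ : EFin \o _ = cst 0%E); first exact: integrable0.
by apply/funext => t/=; rewrite expr0n.
Qed.

Lemma square_integrableZ c f : square_integrable f ->
  square_integrable (fun t => c * f t).
Proof.
move=> [mf f2]; split; first exact: measurable_funM.
rewrite (_ : EFin \o _ = (fun t => (c ^+ 2)%:E * (f t ^+ 2)%:E)%E).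
  exact: integrableZl.
by apply/funext => t/=; rewrite exprMn EFinM.
Qed.

Lemma square_integrableD f g : square_integrable f -> square_integrable g ->
  square_integrable (fun t => f t + g t).
Proof.
move=> sf sg; have [[mf f2] [mg g2]] := (sf, sg).
split; first exact: measurable_funD.
rewrite (_ : EFin \o _ = ((EFin \o (fun t => f t ^+ 2)%R) \+
    ((fun t => 2%:E * (f t * g t)%:E) \+ (EFin \o (fun t => g t ^+ 2)%R)))%E).
  apply: integrableD => //; apply: integrableD => //.
  by apply: integrableZl => //; exact: integrable_inner.
by apply/funext => t/=; rewrite -EFinM -!EFinD; congr (_%:E); ring.
Qed.

Lemma square_integrable_sum (I : Type) (s : seq I) (F : I -> R -> R) :
  (forall i, square_integrable (F i)) ->
  square_integrable (fun t => \sum_(i <- s) F i t).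
Proof.
move=> sF; elim: s => [|i s ih].
  by under eq_fun do rewrite big_nil; exact: square_integrable0.
by under eq_fun do rewrite big_cons; exact: square_integrableD.
Qed.

Lemma square_integrable_shift c f : square_integrable f ->
  square_integrable (fun t => f (t + c)).
Proof.
move=> [mf f2]; split; last exact: (integrable_shift c (fun t => f t ^+ 2)).
by apply: (measurableT_comp mf); exact: measurable_shift.
Qed.

Lemma square_integrable_indic (D : set R) f : measurable D ->
  square_integrable f -> square_integrable (fun t => f t * \1_D t).
Proof.
move=> mD [mf f2].
have mfD : measurable_fun setT (fun t => f t * \1_D t) by exact: measurable_funM.
split=> //; apply: le_integrable f2 => //.
  by apply/measurable_EFinP; exact: measurable_funX.
move=> t _ /=; rewrite lee_fin !ger0_norm ?sqr_ge0// exprMn.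
by rewrite indicE; case: (_ \in _); rewrite ?expr1n ?expr0n ?mulr1 ?mulr0 ?sqr_ge0.
Qed.

Lemma innerC f g : inner f g = inner g f.
Proof. by apply: eq_Rintegral => t _; rewrite mulrC. Qed.

Lemma innerDl f g h : square_integrable f -> square_integrable g ->
  square_integrable h ->
  inner (fun t => f t + g t) h = inner f h + inner g h.
Proof.
move=> sf sg sh; rewrite -RintegralD//; try exact: integrable_inner.
by apply: eq_Rintegral => t _; rewrite mulrDl.
Qed.

Lemma innerZl c f h : square_integrable f -> square_integrable h ->
  inner (fun t => c * f t) h = c * inner f h.
Proof.
move=> sf sh; rewrite -RintegralZl//; last exact: integrable_inner.
by apply: eq_Rintegral => t _; rewrite mulrA.
Qed.

Lemma inner_suml (I : Type) (s : seq I) (F : I -> R -> R) h :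
  (forall i, square_integrable (F i)) -> square_integrable h ->
  inner (fun t => \sum_(i <- s) F i t) h = \sum_(i <- s) inner (F i) h.
Proof.
move=> sF sh; elim: s => [|i s ih].
  under eq_fun do rewrite big_nil; rewrite big_nil /inner.
  by under eq_Rintegral do rewrite mul0r; rewrite Rintegral_cst// mul0r.
under eq_fun do rewrite big_cons.
by rewrite innerDl//; [rewrite big_cons ih|exact: square_integrable_sum].
Qed.

Lemma inner_sumr (I : Type) (s : seq I) (F : I -> R -> R) h :
  (forall i, square_integrable (F i)) -> square_integrable h ->
  inner h (fun t => \sum_(i <- s) F i t) = \sum_(i <- s) inner h (F i).
Proof.
by move=> sF sh; rewrite innerC inner_suml//; apply: eq_bigr => i _; rewrite innerC.
Qed.

Lemma inner_shift c f g : square_integrable f -> square_integrable g ->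
  inner (fun t => f (t + c)) (fun t => g (t + c)) = inner f g.
Proof.
move=> [mf _] [mg _].
by apply: (Rintegral_shift c (fun t => f t * g t)); exact: measurable_funM.
Qed.

Lemma inner_ge0 f : 0 <= inner f f.
Proof. by apply: Rintegral_ge0 => t _; rewrite -expr2 sqr_ge0. Qed.

Lemma inner_eq0 f : square_integrable f -> inner f f = 0 ->
  {ae mu, forall t, f t = 0}.
Proof.
move=> sf f0; have [mf f2] := sf.
have mf2 : measurable_fun setT (EFin \o (fun t => f t ^+ 2)%R).
  by apply/measurable_EFinP; exact: measurable_funX.
have : (\int[mu]_t `|(EFin \o (fun t => f t ^+ 2)%R) t| = 0)%E.
  move: f0; rewrite /inner /Rintegral => f0.
  (* [fine] sends infinity to [0], so a vanishing [Rintegral] says something about the integral only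
     once its finiteness is known. *)
  rewrite -[LHS]fineK.
    rewrite -[0%E]/(0%:E) -f0; congr (fine _)%:E; apply: eq_integral => t _ /=.
    by rewrite ger0_norm ?sqr_ge0// expr2.
  by move/integrableP: f2 => [_ ?]; rewrite ge0_fin_numE// integral_ge0.
move/(ae_eq_integral_abs mu measurableT mf2).
by apply: filterS => t /(_ I)/= [] /eqP; rewrite sqrf_eq0 => /eqP.
Qed.

End square_integrable.

(** * The spectrum of the pulse *)

Section pulse_spectrum.
Context {R : realType}.
Local Notation mu := (@lebesgue_measure R).
Variables (s : R -> R) (tau Ts : R).
Hypotheses (Ts_gt0 : 0 < Ts) (sW : waveform s Ts 2) (tau_itv : 0 < tau < Ts).
Implicit Types (a b : 'I_2) (t w : R).

(** The part of [Svec s tau a] in slot [k], moved back to the origin. The slot is half-open so that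
    its translates tile the line without overlap. *)
Definition pulse a (k : nat) t : R :=
  Svec s tau a (t + k%:R * Ts) * \1_(`[0, Ts[%classic) t.

Let square_integrable_s : square_integrable s.
Proof. by case: sW => ms _ s2 _; split. Qed.

Let square_integrable_Svec a : square_integrable (Svec s tau a).
Proof.
rewrite /Svec; case: (val a == 0%N); first exact: square_integrable_s.
exact: (square_integrable_shift (- tau)).
Qed.

Lemma square_integrable_pulse a k : square_integrable (pulse a k).
Proof. exact/square_integrable_indic/square_integrable_shift. Qed.

(** The delayed copy ends at [2 * Ts + tau < 3 * Ts], so three half-open slots contain both
    signals. *)
Let Svec_out a t : ~~ (0 <= t < 3 * Ts) -> Svec s tau a t = 0.
Proof.
case: sW => _ s0 _ _ tout; rewrite /Svec; case: ifP => _; apply: s0;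
  rewrite in_itv/=; apply/negP => /andP[t0 t2];
  move/negP: tout; apply; apply/andP; move/andP: tau_itv => []; split; lra.
Qed.

(** Every point of [[0, 3 * Ts[] lies in exactly one of the three slots, so the indicators add up to
    [1] there. *)
Lemma Svec_pulse a t :
  Svec s tau a t = \sum_(k < 3) pulse a k (t - k%:R * Ts).
Proof.
under eq_bigr do rewrite /pulse subrK.
rewrite -mulr_sumr; have [t03|/Svec_out->] := boolP (0 <= t < 3 * Ts); last first.
  by rewrite mul0r.
rewrite !big_ord_recl big_ord0/= /bump/= !indicE.
suff -> : (t - 0 * Ts \in `[0, Ts[%classic)%:R +
  ((t - 1 * Ts \in `[0, Ts[%classic)%:R +
  ((t - 2 * Ts \in `[0, Ts[%classic)%:R + 0)) = 1 :> R by rewrite mulr1.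
rewrite !mem_setE !in_itv/=; move/andP: t03 => [t0 t3].
have [t1|t1] := ltP t Ts; have [t2|t2] := ltP t (2 * Ts).
- rewrite (_ : (_ <= t - 0 * Ts) && _); last by apply/andP; split; lra.
  rewrite (_ : (_ <= t - 1 * Ts) = false); last by apply/negbTE; rewrite -ltNge; lra.
  rewrite (_ : (_ <= t - 2 * Ts) = false); last by apply/negbTE; rewrite -ltNge; lra.
  by rewrite !andFb/=; ring.
- exfalso; lra.
- rewrite (_ : (t - 0 * Ts < _) = false); last by apply/negbTE; rewrite -leNgt; lra.
  rewrite (_ : (_ <= t - 1 * Ts) && _); last by apply/andP; split; lra.
  rewrite (_ : (_ <= t - 2 * Ts) = false); last by apply/negbTE; rewrite -ltNge; lra.
  by rewrite andbF/=; ring.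
- rewrite (_ : (t - 0 * Ts < _) = false); last by apply/negbTE; rewrite -leNgt; lra.
  rewrite (_ : (t - 1 * Ts < _) = false); last by apply/negbTE; rewrite -leNgt; lra.
  rewrite (_ : (_ <= t - 2 * Ts) && _); last by apply/andP; split; lra.
  by rewrite !andbF/=; ring.
Qed.

Let slot_disjoint (p q : int) t : p != q ->
  \1_(`[0, Ts[%classic) (t - p%:~R * Ts) * \1_(`[0, Ts[%classic) (t - q%:~R * Ts)
  = 0 :> R.
Proof.
wlog pq : p q / p < q => [H|_].
  rewrite neq_lt => /orP[pq|qp]; first by rewrite H// lt_eqF.
  by rewrite mulrC H// lt_eqF.
rewrite !indicE !mem_setE !in_itv/=.
case: (boolP (0 <= t - q%:~R * Ts)) => tq; last by rewrite andFb mulr0.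
rewrite (_ : (t - p%:~R * Ts < Ts) = false) ?andbF ?mul0r//.
apply/negbTE; rewrite -leNgt.
have : (p + 1)%:~R <= q%:~R :> R by rewrite ler_int; lia.
rewrite intrD -(ler_pM2r Ts_gt0); lra.
Qed.

(** Slot [l] of the signal delayed by [m] symbols occupies slot [l + m] of the line. It is either
    disjoint from slot [k] or equal to it, and then a translation brings both back to the origin. *)
Let inner_slot a b (k l : nat) (m : int) :
  inner (fun t => pulse a k (t - k%:R * Ts))
        (fun t => pulse b l (t - m%:~R * Ts - l%:R * Ts)) =
  (k%:Z - l%:Z == m)%:R * inner (pulse a k) (pulse b l).
Proof.
have tE t : t - m%:~R * Ts - l%:R * Ts = t - (m + l%:Z)%:~R * Ts.
  by rewrite intrD -pmulrn; ring.
have [klm|klm] := eqVneq (k%:Z - l%:Z) m.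
  rewrite mul1r -[RHS](inner_shift (- (k%:R * Ts))); try exact: square_integrable_pulse.
  by congr inner; apply/funext => t; rewrite tE -klm subrK -pmulrn.
rewrite mul0r /inner (_ : (fun t => _) = (fun=> 0)); last first.
  apply/funext => t; rewrite tE /pulse mulrACA.
  rewrite (_ : t - k%:R * Ts = t - (k%:Z)%:~R * Ts)//.
  rewrite slot_disjoint ?mulr0//.
  by apply: contra_neq klm => ->; rewrite addrK.
by rewrite Rintegral_cst// mul0r.
Qed.

Lemma Gram_pulse (m : int) a b : Gram s tau Ts m a b =
  \sum_(k < 3) \sum_(l < 3) (k%:Z - l%:Z == m)%:R * inner (pulse a k) (pulse b l).
Proof.
have -> : Gram s tau Ts m a b =
    inner (fun t => \sum_(k < 3) pulse a k (t - k%:R * Ts))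
          (fun t => \sum_(l < 3) pulse b l (t - m%:~R * Ts - l%:R * Ts)).
  by apply: eq_Rintegral => t _; rewrite -!Svec_pulse.
have sp c k x : square_integrable (fun t => pulse c k (t + x)).
  exact/square_integrable_shift/square_integrable_pulse.
have sp2 c k : square_integrable
    (fun t => pulse c k (t - m%:~R * Ts - k%:R * Ts)).
  by under eq_fun do rewrite -addrA; exact: sp.
rewrite inner_suml//; last exact: square_integrable_sum.
apply: eq_bigr => k _; rewrite inner_sumr//.
by apply: eq_bigr => l _; exact: inner_slot.
Qed.

(** For [f = cos] this is the real part of the entry of [Ttilde], for [f = sin] the opposite of its
    imaginary part. *)
Definition spectrum (f : R -> R) a b w : R :=
  \sum_(k < 3) \sum_(l < 3)
    inner (pulse a k) (pulse b l) * f ((k%:Z - l%:Z)%:~R * w).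

Let sum_Gram (f : int -> R) a b (n : nat) : (2 <= n)%N ->
  \sum_(i < n.*2.+1) Gram s tau Ts (i%:Z - n%:Z) a b * f (i%:Z - n%:Z) =
  \sum_(k < 3) \sum_(l < 3)
    inner (pulse a k) (pulse b l) * f (k%:Z - l%:Z).
Proof.
(* [n >= 2] because [k - l] ranges over [-2 .. 2] *)
move=> n2; under eq_bigr => i _.
  rewrite Gram_pulse mulr_suml; under eq_bigr do rewrite mulr_suml.
  over.
rewrite exchange_big/=; apply: eq_bigr => k _.
rewrite exchange_big/=; apply: eq_bigr => l _.
have kln : (k + n - l < n.*2.+1)%N.
  by have := ltn_ord k; have := ltn_ord l; lia.
(* The summation index is shifted by [n], so the only lag that contributes, [k - l], sits at index
   [k + n - l]. *)
rewrite (bigD1 (Ordinal kln))//= big1 ?addr0.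
  have -> : (k + n - l)%:Z - n%:Z = k%:Z - l%:Z.
    by have := ltn_ord k; have := ltn_ord l; lia.
  by rewrite eqxx mul1r.
move=> i /eqP ikl; case: eqP => [E|_]; last by rewrite !mul0r.
exfalso; apply: ikl; apply/val_inj => /=.
by have := ltn_ord k; have := ltn_ord l; lia.
Qed.

(** Only the lags from -2 to 2 have nonzero Gram entries, so the partial sums are constant from
    [n = 2] on and the limit is that constant. *)
Lemma Ttilde_spectrum a b w : Ttilde s tau Ts a b w =
  Complex (spectrum cos a b w) (- spectrum sin a b w).
Proof.
have n2 : \forall n \near \oo, (2 <= n)%N by exact: nbhs_infty_ge.
rewrite /Ttilde; congr Complex; apply: lim_near_cst => //;
  apply: filterS n2 => n n2; rewrite /Ttilde_partial raddf_sum /=.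
  apply/esym; apply: etrans (esym (sum_Gram (fun k => cos (k%:~R * w)) a b _ n2)) _.
  by apply: eq_bigr => i _ /=; rewrite mul0r subr0.
apply/esym; rewrite -[RHS]opprK; congr -%R.
apply: etrans (esym (sum_Gram (fun k => sin (k%:~R * w)) a b _ n2)) _.
by rewrite -sumrN; apply: eq_bigr => i _ /=; rewrite mul0r addr0 mulrN opprK.
Qed.

Lemma continuous_spectrum (f : R -> R) a b : continuous f ->
  continuous (spectrum f a b).
Proof.
move=> cf; rewrite /spectrum.
apply: continuous_big => [|k _];
  first exact: (@pseudometric_normed_Zmodule.add_continuous _ R^o).
apply: continuous_big => [|l _ w];
  first exact: (@pseudometric_normed_Zmodule.add_continuous _ R^o).
apply: cvgM; first exact: cvg_cst.
apply: continuous_comp; last exact: cf.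
by apply: cvgM; [exact: cvg_cst|exact: cvg_id].
Qed.

End pulse_spectrum.

Section inner_combination.
Context {R : realType}.
Implicit Types f g h : R -> R.

Lemma inner_sqr3 (x y z : R) f g h : square_integrable f -> square_integrable g ->
  square_integrable h ->
  inner (fun t => x * f t + y * g t + z * h t)
        (fun t => x * f t + y * g t + z * h t) =
  x ^+ 2 * inner f f + y ^+ 2 * inner g g + z ^+ 2 * inner h h +
  2 * (x * y * inner f g + x * z * inner f h + y * z * inner g h).
Proof.
move=> sf sg sh.
have sxf := square_integrableZ x _ sf; have syg := square_integrableZ y _ sg.
have szh := square_integrableZ z _ sh; have sfg := square_integrableD _ _ sxf syg.
have sfgh := square_integrableD _ _ sfg szh.
rewrite !innerDl// !innerZl// !(innerC _ (fun t => _ + _)).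
rewrite !innerDl// !innerZl// (innerC g f) (innerC h f) (innerC h g).
ring.
Qed.

End inner_combination.

(** * Positive definiteness of the spectrum *)

Section spectrum_positivity.
Context {R : realType}.
Local Notation mu := (@lebesgue_measure R).
Variables (s : R -> R) (tau Ts : R).
Hypotheses (Ts_gt0 : 0 < Ts) (sW : waveform s Ts 2) (tau_itv : 0 < tau < Ts).
Implicit Types (a b : 'I_2) (t w : R).

Local Notation pls := (pulse s tau Ts).
Local Notation spec := (spectrum s tau Ts).

Let sqpulse a k : square_integrable (pls a k).
Proof. exact: square_integrable_pulse. Qed.

(** On [[0, Ts[], the choices [cos] and [sin] of [f] give the real and imaginary parts of [F1] for
    [a = i0] and of [F2] for [a = i1]. *)
Definition modulated (f : R -> R) a w t : R :=
  \sum_(k < 3) f (k%:R * w) * pls a k t.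

Lemma square_integrable_modulated f a w : square_integrable (modulated f a w).
Proof.
by apply: square_integrable_sum => k; exact/square_integrableZ/sqpulse.
Qed.

Lemma inner_modulated f g a b w :
  inner (modulated f a w) (modulated g b w) =
  \sum_(k < 3) \sum_(l < 3)
    inner (pls a k) (pls b l) * (f (k%:R * w) * g (l%:R * w)).
Proof.
have sp h c (k : 'I_3) : square_integrable (fun t => h (k%:R * w) * pls c k t).
  exact/square_integrableZ/sqpulse.
rewrite inner_suml//; last exact: square_integrable_modulated.
apply: eq_bigr => k _; rewrite inner_sumr//.
apply: eq_bigr => l _; rewrite innerZl; [|exact: sqpulse|exact: sp].
rewrite innerC innerZl; [|exact: sqpulse|exact: sqpulse].
by rewrite innerC; ring.
Qed.

(** The addition formula for [cos (k w - l w)] separates the two indices. This is the real part of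
    the complex inner product of the modulated signals; the sine version is the imaginary part up to
    sign. *)
Lemma spectrum_cos a b w : spec cos a b w =
  inner (modulated cos a w) (modulated cos b w) +
  inner (modulated sin a w) (modulated sin b w).
Proof.
rewrite !inner_modulated -big_split/=; apply: eq_bigr => k _.
rewrite -big_split/=; apply: eq_bigr => l _.
by rewrite -mulrDr intrB mulrBl cosB.
Qed.

Lemma spectrum_sin a b w : spec sin a b w =
  inner (modulated sin a w) (modulated cos b w) -
  inner (modulated cos a w) (modulated sin b w).
Proof.
rewrite !inner_modulated -sumrB/=; apply: eq_bigr => k _.
rewrite -sumrB/=; apply: eq_bigr => l _.
by rewrite -mulrBr intrB mulrBl sinB.
Qed.

Let modulatedE f a w t : t \in `[0, Ts[%R ->
  modulated f a w t = \sum_(k < 3) f (k%:R * w) * Svec s tau a (t + k%:R * Ts).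
Proof.
move=> tT; apply: eq_bigr => k _; rewrite /pulse indicE.
by rewrite mem_setE tT mulr1.
Qed.

Let F1E t w : t \in `[0, Ts[%R ->
  F1 s Ts 2 t w = Complex (modulated cos i0 w t) (modulated sin i0 w t).
Proof.
move=> tT; rewrite !modulatedE//; apply/eqP; rewrite eq_complex /F1 !raddf_sum/=.
by apply/andP; split; apply/eqP/eq_bigr => k _; rewrite /Svec/=; ring.
Qed.

Let F2E t w : t \in `[0, Ts[%R ->
  F2 s tau Ts 2 t w = Complex (modulated cos i1 w t) (modulated sin i1 w t).
Proof.
move=> tT; rewrite !modulatedE//; apply/eqP; rewrite eq_complex /F2 !raddf_sum/=.
by apply/andP; split; apply/eqP/eq_bigr => k _; rewrite /Svec/= (addrAC t); ring.
Qed.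

Hypothesis indep : lin_indep_condition s tau Ts 2.
Variable w : R.
Hypothesis w_itv : w \in `[- pi, pi].

Let A a := modulated cos a w.
Let B a := modulated sin a w.

(** The independence condition in real terms: the two hypotheses are the real and imaginary parts of
    [c1 F1 + c2 F2 = 0] for [c1 = p1 + i q1] and [c2 = p2 + i q2]. *)
Let indep_modulated (p1 q1 p2 q2 : R) :
  {ae mu, forall t, p1 * A i0 t - q1 * B i0 t + (p2 * A i1 t - q2 * B i1 t) = 0} ->
  {ae mu, forall t, p1 * B i0 t + q1 * A i0 t + (p2 * B i1 t + q2 * A i1 t) = 0} ->
  [/\ p1 = 0, q1 = 0, p2 = 0 & q2 = 0].
Proof.
move=> h1 h2.
have [|[-> ->] [-> ->]//] := indep w w_itv (Complex p1 q1) (Complex p2 q2).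
(* The condition is on the closed interval, the pulses live on the half-open one; the endpoint [Ts]
   is a null set. *)
have hT : {ae mu, forall t, t != Ts}.
  exists [set Ts]; split => //; first exact: lebesgue_measure_set1.
  by move=> t /= /negP; rewrite negbK => /eqP.
move: h1 h2 hT; apply: (@filterS3 _ _ (ae_filter_ringOfSetsType mu)) => t h1 h2 tT t0T.
have t0T' : t \in `[0, Ts[%R.
  by move: t0T; rewrite !in_itv/= lt_neqAle tT.
rewrite F1E// F2E//; apply/eqP; rewrite eq_complex/=.
by apply/andP; split; apply/eqP.
Qed.

(** The value is the squared norm of [F1]. Were it zero, the coefficients [c1 = 1] and [c2 = 0]
    would contradict independence. *)
Lemma spectrum_diag_gt0 : 0 < spec cos i0 i0 w.
Proof.
rewrite spectrum_cos lt_neqAle addr_ge0 ?inner_ge0// andbT eq_sym.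
rewrite paddr_eq0 ?inner_ge0//; apply/negP => /andP[/eqP A0 /eqP B0].
have hA := inner_eq0 _ (square_integrable_modulated _ _ _) A0.
have hB := inner_eq0 _ (square_integrable_modulated _ _ _) B0.
have [||/eqP] := indep_modulated 1 0 0 0; last by rewrite oner_eq0.
  by move: hA hB; apply: (@filterS2 _ _ (ae_filter_ringOfSetsType mu)) => t hA hB;
    rewrite /A /B hA; ring.
by move: hA hB; apply: (@filterS2 _ _ (ae_filter_ringOfSetsType mu)) => t hA hB;
    rewrite /A /B hB; ring.
Qed.

(* Up to the factor [T11], the determinant is the squared norm of
   [c1 F1 + c2 F2] for [c1 = - <F2, F1>] and [c2 = <F1, F1>]. *)
Lemma Re_det_gt0 : 0 < complex.Re (detTtilde s tau Ts w).
Proof.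
have a0 := spectrum_diag_gt0.
rewrite /detTtilde !(Ttilde_spectrum _ _ _ Ts_gt0 sW tau_itv)/=.
set a := spec cos i0 i0 w.
set x := spec cos i0 i1 w; set y := - spec sin i0 i1 w.
(* Hermitian symmetry: the off-diagonal entries are [x + i y] and its conjugate, and the diagonal
   entry [a] is real. *)
have -> : spec cos i1 i0 w = x.
  by rewrite /x !spectrum_cos; congr (_ + _); rewrite innerC.
have -> : spec sin i1 i0 w = y.
  rewrite /y !spectrum_sin opprB; congr (_ - _); rewrite innerC//.
have -> : spec sin i0 i0 w = 0.
  by rewrite spectrum_sin innerC subrr.
rewrite -(pmulr_rgt0 _ a0) -/a.
(* [X] and [Y] are the real and imaginary parts of [c1 F1 + c2 F2] with [c1 = - (x + i y)] and
   [c2 = a]. *)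
pose X t := - x * A i0 t + y * B i0 t + a * A i1 t.
pose Y t := - x * B i0 t + - y * A i0 t + a * B i1 t.
have sA c : square_integrable (A c) by exact: square_integrable_modulated.
have sB c : square_integrable (B c) by exact: square_integrable_modulated.
have sX : square_integrable X.
  apply: square_integrableD; last exact: square_integrableZ.
  by apply: square_integrableD; exact: square_integrableZ.
have sY : square_integrable Y.
  apply: square_integrableD; last exact: square_integrableZ.
  by apply: square_integrableD; exact: square_integrableZ.
set D := (X in a * X); have -> : a * D = inner X X + inner Y Y.
  rewrite !inner_sqr3// (innerC (B i0) (A i0)) /D.
  have aE : a = inner (A i0) (A i0) + inner (B i0) (B i0) by exact: spectrum_cos.
  have bE : spec cos i1 i1 w = inner (A i1) (A i1) + inner (B i1) (B i1).
    exact: spectrum_cos.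
  have xE : x = inner (A i0) (A i1) + inner (B i0) (B i1) by exact: spectrum_cos.
  have yE : y = inner (A i0) (B i1) - inner (B i0) (A i1).
    by rewrite /y spectrum_sin opprB.
  rewrite bE.
  (* Three inner products are eliminated in favour of [a], [x] and [y]; what remains is a polynomial
     identity. *)
  have -> : inner (A i0) (A i0) = a - inner (B i0) (B i0) by rewrite aE addrK.
  have -> : inner (A i0) (A i1) = x - inner (B i0) (B i1) by rewrite xE addrK.
  have -> : inner (A i0) (B i1) = y + inner (B i0) (A i1) by rewrite yE subrK.
  by ring.
rewrite lt_neqAle addr_ge0 ?inner_ge0// andbT eq_sym.
rewrite paddr_eq0 ?inner_ge0//; apply/negP => /andP[/eqP X0 /eqP Y0].
have [||_ _ a_eq0 _] := indep_modulated (- x) (- y) a 0.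
- by apply: (@filterS _ _ (ae_filter_ringOfSetsType mu)) (inner_eq0 _ sX X0) => t;
    rewrite /X => h; rewrite -[RHS]h; ring.
- by apply: (@filterS _ _ (ae_filter_ringOfSetsType mu)) (inner_eq0 _ sY Y0) => t;
    rewrite /Y => h; rewrite -[RHS]h; ring.
- by move: a0; rewrite -/a a_eq0 ltxx.
Qed.

End spectrum_positivity.

(** * Uniform bounds on the spectrum over all frequencies *)

Section spectrum_bounds.
Context {R : realType}.
Variables (s : R -> R) (tau Ts : R).
Hypotheses (Ts_gt0 : 0 < Ts) (sW : waveform s Ts 2) (tau_itv : 0 < tau < Ts).

Lemma continuous_Re_Ttilde11 :
  continuous (fun w => complex.Re (Ttilde11 s tau Ts w)).
Proof.
rewrite (_ : (fun w => _) = spectrum s tau Ts cos i0 i0).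
  exact/continuous_spectrum/continuous_cos.
by apply/funext => w; rewrite /Ttilde11 Ttilde_spectrum.
Qed.

Lemma continuous_Re_detTtilde :
  continuous (fun w => complex.Re (detTtilde s tau Ts w)).
Proof.
pose c a b w := spectrum s tau Ts cos a b w.
pose n a b w := - spectrum s tau Ts sin a b w.
rewrite (_ : (fun w => _) = (fun w => c i0 i0 w * c i1 i1 w - n i0 i0 w * n i1 i1 w
  - (c i0 i1 w * c i1 i0 w - n i0 i1 w * n i1 i0 w))); last first.
  by apply/funext => w; rewrite /detTtilde !Ttilde_spectrum.
move=> w.
have cc a b : {for w, continuous (c a b)}.
  exact/continuous_spectrum/continuous_cos.
have cs a b : {for w, continuous (n a b)}.
  by apply: (@cvgN _ R^o); exact/continuous_spectrum/continuous_sin.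
by apply: (@cvgB _ R^o); apply: (@cvgB _ R^o); apply: cvgM; (exact: cc || exact: cs).
Qed.

Lemma spectrum_bounds : lin_indep_condition s tau Ts 2 ->
  exists c C : R, [/\ 0 < c, 0 < C & forall w, w \in `[- pi, pi] ->
    [/\ c <= complex.Re (Ttilde11 s tau Ts w),
        complex.Re (Ttilde11 s tau Ts w) <= C &
        c ^+ 2 <= complex.Re (detTtilde s tau Ts w)]].
Proof.
move=> indep.
have pp : - pi <= pi :> R by have := pi_ge0 R; lra.
have c1 := continuous_subspaceT continuous_Re_Ttilde11.
have c2 := continuous_subspaceT continuous_Re_detTtilde.
have [w1 w1_itv min1] := EVT_min pp (c1 _).
have [w2 w2_itv min2] := EVT_min pp (c2 _).
have [w3 w3_itv max3] := EVT_max pp (c1 _).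
have T11_gt0 w : w \in `[- pi, pi] -> 0 < complex.Re (Ttilde11 s tau Ts w).
  by move=> wpi; rewrite /Ttilde11 Ttilde_spectrum//; exact: spectrum_diag_gt0.
have m1 := T11_gt0 _ w1_itv.
have m2 := Re_det_gt0 _ _ _ Ts_gt0 sW tau_itv indep _ w2_itv.
(* The square root makes [c ^+ 2] a lower bound of the determinant, the form in which the two-relay
   integrand factors. *)
exists (Num.min (complex.Re (Ttilde11 s tau Ts w1))
                (Num.sqrt (complex.Re (detTtilde s tau Ts w2)))).
exists (complex.Re (Ttilde11 s tau Ts w3)); split.
- by rewrite lt_min m1 sqrtr_gt0 m2.
- exact: T11_gt0.
- move=> w wpi; split; first by rewrite ge_min min1.
    exact: max3.
  apply: le_trans (min2 _ wpi); rewrite -[leRHS]sqr_sqrtr; last exact: ltW.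
  rewrite ler_sqr ?nnegrE ?sqrtr_ge0//; first by rewrite ge_min lexx orbT.
  by rewrite le_min sqrtr_ge0 ltW.
Qed.

End spectrum_bounds.

(** * Averages over the frequency interval *)

Section spectral_average.
Context {R : realType}.
Local Notation mu := (@lebesgue_measure R).
Implicit Types f : R -> R.

Lemma le_average f g : {in `[- pi, pi], continuous f} ->
  {in `[- pi, pi], continuous g} ->
  (forall w, w \in `[- pi, pi] -> f w <= g w) ->
  (2 * pi)^-1 * Rintegral mu `[- pi, pi] f <=
  (2 * pi)^-1 * Rintegral mu `[- pi, pi] g.
Proof.
have intf h : {in `[- pi, pi], continuous h} ->
    mu.-integrable `[- pi, pi] (EFin \o h).
  move=> ch; apply: continuous_compact_integrable; first exact: segment_compact.
  by apply: continuous_in_subspaceT => x; rewrite mem_setE; exact: ch.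
move=> cf cg fg; rewrite ler_pM2l ?invr_gt0 ?mulr_gt0 ?pi_gt0//.
by apply: le_Rintegral => //; exact: intf.
Qed.

Lemma average_cst (x : R) : (2 * pi)^-1 * Rintegral mu `[- pi, pi] (fun=> x) = x.
Proof.
have pi0 := pi_gt0 R.
rewrite Rintegral_cst//= lebesgue_measure_itv/= lte_fin ifT; last by lra.
rewrite -EFinD/= mulrCA opprK (_ : pi + pi = 2 * pi); last by ring.
by rewrite mulVf ?mulr1// mulf_neq0// gt_eqF.
Qed.

Lemma average_ge (m : R) f : {in `[- pi, pi], continuous f} ->
  (forall w, w \in `[- pi, pi] -> m <= f w) ->
  m <= (2 * pi)^-1 * Rintegral mu `[- pi, pi] f.
Proof.
move=> cf mf; rewrite -[leLHS]average_cst.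
by apply: le_average => // w _; exact: cvg_cst.
Qed.

Lemma average_le (M : R) f : {in `[- pi, pi], continuous f} ->
  (forall w, w \in `[- pi, pi] -> f w <= M) ->
  (2 * pi)^-1 * Rintegral mu `[- pi, pi] f <= M.
Proof.
move=> cf fM; rewrite -[leRHS]average_cst.
by apply: le_average => // w _; exact: cvg_cst.
Qed.

(** By Tonelli, whence the nonnegativity assumption. It serves to show that the mutual informations
    are random variables. *)
Lemma measurable_Rintegral_param (d : measure_display) (T : measurableType d)
    (D : set R) (F : T -> R -> R) : measurable D ->
  measurable_fun setT (fun xy : T * R => F xy.1 xy.2) ->
  (forall x y, D y -> 0 <= F x y) ->
  measurable_fun setT (fun x => Rintegral mu D (F x)).
Proof.
move=> mD mF F0; rewrite /Rintegral.
apply: measurableT_comp => //.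
(* An indicator replaces the restriction to [D], so that the integrand is defined on the whole
   product space. *)
pose f (xy : T * measurableTypeR R) : \bar R := (F xy.1 xy.2 * \1_D xy.2)%:E.
rewrite (_ : (fun x => _) = fubini_F mu f).
  apply: measurable_fun_fubini_tonelli_F.
    apply/measurable_EFinP; apply: measurable_funM => //.
    by apply: measurableT_comp => //; exact: measurable_indic.
  move=> [x y]/=; rewrite lee_fin indicE.
  have [yD|_] := boolP (y \in D); last by rewrite mulr0.
  by rewrite mulr1 F0//; exact/set_mem.
apply/funext => x; rewrite integral_mkcond/= /fubini_F.
apply: eq_integral => y _; rewrite restrict_EFin/= /f/= patch_indic.
by [].
Qed.

End spectral_average.

(** * Mutual informations *)

Section log2.
Context {R : realType}.
Implicit Types x y : R.

Lemma ln2_gt0 : 0 < ln 2 :> R.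
Proof. by apply: ln_gt0; lra. Qed.

Lemma ler_log2 x y : 0 < x -> x <= y -> log2 x <= log2 y.
Proof.
move=> x0 xy; rewrite /log2 ler_pM2r ?invr_gt0 ?ln2_gt0//.
by rewrite ler_ln ?posrE// (lt_le_trans x0).
Qed.

Lemma log2_ge0 x : 1 <= x -> 0 <= log2 x.
Proof.
by move=> x1; apply: divr_ge0; [exact: ln_ge0|exact/ltW/ln2_gt0].
Qed.

Lemma measurable_log2 : measurable_fun setT (@log2 R).
Proof. by apply: measurable_funM => //; exact: measurable_ln. Qed.

Lemma continuous_log2 x : 0 < x -> {for x, continuous (@log2 R)}.
Proof.
by move=> x0; apply: cvgM; [exact: continuous_ln|exact: cvg_cst].
Qed.

End log2.

Section mutual_information.
Context {R : realType}.
Variables (s : R -> R) (tau Ts : R).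
Hypotheses (Ts_gt0 : 0 < Ts) (sW : waveform s Ts 2) (tau_itv : 0 < tau < Ts).
Variables (c C : R).
Hypothesis c_gt0 : 0 < c.
Local Notation T11 w := (complex.Re (Ttilde11 s tau Ts w)).
Local Notation detT w := (complex.Re (detTtilde s tau Ts w)).
Hypothesis bounds : forall w, w \in `[- pi, pi] ->
  [/\ c <= T11 w, T11 w <= C & c ^+ 2 <= detT w].
Variable snr : R.
Hypothesis snr_gt0 : 0 < snr.
Implicit Types g : R.

Lemma rho0_gt0 : 0 < rho0 snr.
Proof. by rewrite /rho0 mulr_gt0//; lra. Qed.

Let rhoM_ge0 g : 0 <= g -> 0 <= rho0 snr * g.
Proof. by move=> g0; apply: mulr_ge0 => //; exact/ltW/rho0_gt0. Qed.

Let rhoMM_ge0 g x : 0 <= g -> 0 < x -> 0 <= rho0 snr * g * x.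
Proof. by move=> g0 x0; apply: mulr_ge0; [exact: rhoM_ge0|exact: ltW]. Qed.

Let ESD_arg g w := 1 + rho0 snr * g * T11 w.
Let MacA_arg g1 g2 w :=
  1 + rho0 snr * (g1 + g2) * T11 w + rho0 snr ^+ 2 * g1 * g2 * detT w.

Let I_EMacAE g1 g2 : I_EMacA s tau Ts snr g1 g2 =
  (2 * pi)^-1 * Rintegral lebesgue_measure `[- pi, pi]
    (fun w => log2 (MacA_arg g1 g2 w)).
Proof.
rewrite /I_EMacA; congr (_ * _); apply: eq_Rintegral => w _; congr log2.
rewrite /MacA_arg; case: (Ttilde11 s tau Ts w) => a b.
by case: (detTtilde s tau Ts w) => a' b' /=; ring.
Qed.

Let ESD_arg_ge1 g w : 0 <= g -> w \in `[- pi, pi] -> 1 <= ESD_arg g w.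
Proof.
move=> g0 /bounds[cT _ _]; rewrite /ESD_arg lerDl.
by apply: rhoMM_ge0 => //; exact: lt_le_trans cT.
Qed.

(** Replacing the diagonal entry by [c] and the determinant by [c ^+ 2] leaves exactly the expanded
    product on the left. *)
Let MacA_arg_ge g1 g2 w : 0 <= g1 -> 0 <= g2 -> w \in `[- pi, pi] ->
  (1 + rho0 snr * g1 * c) * (1 + rho0 snr * g2 * c) <= MacA_arg g1 g2 w.
Proof.
move=> g10 g20 /bounds[cT _ cD].
have h1 : rho0 snr * (g1 + g2) * c <= rho0 snr * (g1 + g2) * T11 w.
  by apply: ler_wpM2l => //; apply: rhoM_ge0; exact: addr_ge0.
have h2 : rho0 snr ^+ 2 * g1 * g2 * c ^+ 2 <= rho0 snr ^+ 2 * g1 * g2 * detT w.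
  apply: ler_wpM2l => //; apply: mulr_ge0 => //; apply: mulr_ge0 => //.
  exact: sqr_ge0.
rewrite /MacA_arg; apply: le_trans (lerD (lerD (lexx 1) h1) h2).
by rewrite le_eqVlt; apply/orP; left; apply/eqP; ring.
Qed.

Let prod_ge1 g1 g2 : 0 <= g1 -> 0 <= g2 ->
  1 <= (1 + rho0 snr * g1 * c) * (1 + rho0 snr * g2 * c).
Proof.
move=> g10 g20; rewrite -[leLHS]mulr1.
by apply: ler_pM => //; rewrite lerDl; exact: rhoMM_ge0.
Qed.

Let continuous_ESD g : 0 <= g ->
  {in `[- pi, pi], continuous (fun w => log2 (ESD_arg g w))}.
Proof.
move=> g0 w wpi; have cE : {for w, continuous (ESD_arg g)}.
  apply: (@cvgD _ R^o); first exact: cvg_cst.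
  by apply: cvgM; [exact: cvg_cst|exact: continuous_Re_Ttilde11].
apply: (continuous_comp cE); apply: continuous_log2.
by apply: lt_le_trans (ESD_arg_ge1 _ _ _ wpi).
Qed.

Let continuous_MacA g1 g2 : 0 <= g1 -> 0 <= g2 ->
  {in `[- pi, pi], continuous (fun w => log2 (MacA_arg g1 g2 w))}.
Proof.
move=> g10 g20 w wpi; have cE : {for w, continuous (MacA_arg g1 g2)}.
  apply: (@cvgD _ R^o).
    apply: (@cvgD _ R^o); first exact: cvg_cst.
    by apply: cvgM; [exact: cvg_cst|exact: continuous_Re_Ttilde11].
  by apply: cvgM; [exact: cvg_cst|exact: continuous_Re_detTtilde].
apply: (continuous_comp cE); apply: continuous_log2.
apply: lt_le_trans (MacA_arg_ge _ _ _ _ _ wpi) => //.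
by apply: lt_le_trans (prod_ge1 _ _ _ _).
Qed.

Lemma I_ESD_ge g : 0 <= g -> log2 (1 + rho0 snr * g * c) <= I_ESD s tau Ts snr g.
Proof.
move=> g0.
apply: average_ge; first exact: continuous_ESD.
move=> w wpi; have [cT _ _] := bounds _ wpi; apply: ler_log2.
  by apply: ltr_wpDr => //; exact: rhoMM_ge0.
by rewrite lerD2l; apply: ler_wpM2l => //; exact: rhoM_ge0.
Qed.

Lemma I_ESD_le g : 0 <= g -> I_ESD s tau Ts snr g <= log2 (1 + rho0 snr * g * C).
Proof.
move=> g0.
apply: average_le; first exact: continuous_ESD.
move=> w wpi; have [_ TC _] := bounds _ wpi; apply: ler_log2.
  by apply: lt_le_trans (ESD_arg_ge1 _ _ g0 wpi).
by rewrite lerD2l; apply: ler_wpM2l => //; exact: rhoM_ge0.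
Qed.

Lemma I_EMacA_ge g1 g2 : 0 <= g1 -> 0 <= g2 ->
  log2 ((1 + rho0 snr * g1 * c) * (1 + rho0 snr * g2 * c)) <=
  I_EMacA s tau Ts snr g1 g2.
Proof.
move=> g10 g20; rewrite I_EMacAE.
apply: average_ge; first exact: continuous_MacA.
move=> w wpi; apply: ler_log2; last exact: MacA_arg_ge.
by apply: lt_le_trans (prod_ge1 _ _ g10 g20).
Qed.

Context {d : measure_display} {T : measurableType d}.

Let mT11 : measurable_fun setT (fun xy : T * R => T11 xy.2).
Proof.
apply: (@measurableT_comp _ _ _ _ _ _ (fun w => T11 w)) => //.
by apply: continuous_measurable_fun; exact: continuous_Re_Ttilde11.
Qed.

Let mdetT : measurable_fun setT (fun xy : T * R => detT xy.2).
Proof.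
apply: (@measurableT_comp _ _ _ _ _ _ (fun w => detT w)) => //.
by apply: continuous_measurable_fun; exact: continuous_Re_detTtilde.
Qed.

Let mfst (g : T -> R) : measurable_fun setT g ->
  measurable_fun setT (fun xy : T * R => g xy.1).
Proof. by move=> mg; exact: measurableT_comp. Qed.

Lemma measurable_I_ESD (g : T -> R) : measurable_fun setT g ->
  (forall x, 0 <= g x) ->
  measurable_fun setT (fun x => I_ESD s tau Ts snr (g x)).
Proof.
move=> mg g0; apply: measurable_funM => //.
apply: measurable_Rintegral_param => //=.
  apply: measurableT_comp; first exact: measurable_log2.
  apply: measurable_funD => //; apply: measurable_funM => //.
  by apply: measurable_funM => //; exact: mfst.
by move=> x y ypi; apply: log2_ge0; exact: ESD_arg_ge1.
Qed.

Lemma measurable_I_EMacA (g1 g2 : T -> R) : measurable_fun setT g1 ->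
  measurable_fun setT g2 -> (forall x, 0 <= g1 x) -> (forall x, 0 <= g2 x) ->
  measurable_fun setT (fun x => I_EMacA s tau Ts snr (g1 x) (g2 x)).
Proof.
move=> mg1 mg2 g10 g20; under eq_fun do rewrite I_EMacAE.
apply: measurable_funM => //; apply: measurable_Rintegral_param => //=.
  apply: measurableT_comp; first exact: measurable_log2.
  apply: measurable_funD; last first.
    apply: measurable_funM => //; apply: measurable_funM; last exact: mfst.
    by apply: measurable_funM => //; exact: mfst.
  apply: measurable_funD => //; apply: measurable_funM => //.
  by apply: measurable_funM => //; apply: measurable_funD; exact: mfst.
move=> x y ypi; apply: log2_ge0; apply: le_trans (MacA_arg_ge _ _ _ _ _ ypi) => //.
exact: prod_ge1.
Qed.

End mutual_information.

(** * Gaussian gains *)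

Section centered_normal.
Context {R : realType}.
Local Notation mu := (@lebesgue_measure R).
Variable sd : R.
Hypothesis sd_gt0 : 0 < sd.

Let sd_neq0 : sd != 0. Proof. by rewrite gt_eqF. Qed.

Let integral_cst_ball (k y : R) : 0 < y ->
  (\int[mu]_(x in `](- y)%R, y[) k%:E = (2 * k * y)%:E)%E.
Proof.
move=> y0; rewrite integral_cst//= lebesgue_measure_itv/= lte_fin ifT; last by lra.
by rewrite -EFinD -EFinM opprK; congr (_%:E); ring.
Qed.

Let mpdf (D : set R) : measurable_fun D (fun x => (normal_pdf 0 sd x)%:E).
Proof.
by apply/measurable_EFinP/measurable_funTS; exact: measurable_normal_pdf.
Qed.

(** The density never exceeds its peak and the interval has length [2 * y]. *)
Lemma normal_prob_ball_le (y : R) : 0 < y ->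
  (normal_prob 0 sd `](- y)%R, y[ <= (2 * normal_peak sd * y)%:E)%E.
Proof.
move=> y0; rewrite -integral_cst_ball//; apply: ge0_le_integral => //=.
- by move=> x _; rewrite lee_fin normal_pdf_ge0.
- exact: mpdf.
- by move=> x _; rewrite lee_fin normal_pdf_ub.
Qed.

(** For [y <= 1] the density on the interval is at least its value at [1]. *)
Lemma normal_prob_ball_ge (y : R) : 0 < y <= 1 ->
  ((2 * normal_pdf 0 sd 1 * y)%:E <= normal_prob 0 sd `](- y)%R, y[)%E.
Proof.
move=> /andP[y0 y1]; rewrite -integral_cst_ball//; apply: ge0_le_integral => //=.
- by move=> x _; rewrite lee_fin normal_pdf_ge0.
- exact: mpdf.
- move=> x; rewrite in_itv/= => /andP[yx xy]; rewrite lee_fin !normal_pdfE//.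
  rewrite ler_pM2l ?normal_peak_gt0// /normal_fun ler_expR !subr0 !mulNr lerN2.
  rewrite ler_pM2r ?invr_gt0 ?mulrn_wgt0 ?exprn_gt0// expr1n.
  rewrite -[leRHS](expr1n _ 2) -real_normK ?num_real// ler_sqr ?nnegrE//.
  by rewrite ler_norml; lra.
Qed.

Lemma normal_pdf_gt0 (x : R) : 0 < normal_pdf 0 sd x.
Proof. by rewrite normal_pdfE// mulr_gt0 ?normal_peak_gt0 ?expR_gt0. Qed.

End centered_normal.

(** * Probability that several gains are small together *)

Section gain_boxes.
Context {R : realType} {d : measure_display} {T : measurableType d}.
Variables (P : probability T R) (re im : link -> T -> R) (sigma2 : link -> R).
Hypothesis gains : cscg_independent_gains P re im sigma2.
Hypothesis sigma2_gt0 : forall l, 0 < sigma2 l.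
Implicit Types (J : {set link}) (y : R).

(** Squares in the complex plane rather than disks: the event is then an intersection over the
    independent real components. *)
Definition box J y : set T :=
  [set x | forall l, l \in J -> `|re l x| < y /\ `|im l x| < y].

(** Independence is stated with events for all links at once; those outside [J] get [setT], of
    probability one. *)
Let A J y (l : link) : set R := if l \in J then `](- y), y[%classic else setT.

Let boxE J y : box J y = \bigcap_l (re l @^-1` A J y l `&` im l @^-1` A J y l).
Proof.
apply/seteqP; split => x /= xJ l.
  move=> _; rewrite /A; case: ifPn => [/xJ|//].
  by rewrite !ltr_norml /= !in_itv/=.
by move=> lJ; have [] := xJ l I; rewrite /A lJ /= !in_itv/= !ltr_norml.
Qed.

Let mA J y l : measurable (A J y l).
Proof. by rewrite /A; case: ifP. Qed.

Lemma measurable_box J y : measurable (box J y).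
Proof.
case: gains => mre mim _ _ _; rewrite boxE.
apply: fin_bigcap_measurable; first exact: finite_finset.
move=> l _; apply: measurableI; rewrite -[X in measurable X]setTI;
  by [apply: mre|apply: mim].
Qed.

Let ballp y (l : link) : R :=
  fine (normal_prob 0 (Num.sqrt (sigma2 l / 2)) (`](- y), y[%classic : set R)).

Let sd_gt0 l : 0 < Num.sqrt (sigma2 l / 2).
Proof. by rewrite sqrtr_gt0 divr_gt0. Qed.

Let probability_box J y : fine (P (box J y)) = \prod_(l in J) ballp y l ^+ 2.
Proof.
case: gains => mre mim Pre Pim indep; rewrite boxE indep//.
rewrite (eq_bigr (fun l => (if l \in J then ballp y l ^+ 2 else 1)%:E)); last first.
  move=> l _; rewrite Pre// Pim// /A; case: ifP => _; last first.
    by rewrite -(Pre l)// preimage_setT probability_setT mule1.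
  by rewrite EFinM /ballp fineK// fin_num_measure.
by rewrite prodEFin -big_mkcond.
Qed.

(** Each gain in [J] has two real components, each small with probability of order [y], hence a
    factor of order [y ^+ 2] per gain. *)
Lemma box_bounds : exists a b : R, [/\ 0 < a, 0 < b &
  forall J y, 0 < y ->
    fine (P (box J y)) <= (b * y ^+ 2) ^+ #|J| /\
    (y <= 1 -> (a * y ^+ 2) ^+ #|J| <= fine (P (box J y)))].
Proof.
pose sd l := Num.sqrt (sigma2 l / 2).
(* Constants uniform over the links: a sum of positive terms dominates each of them, and a product
   of numbers capped at [1] is below each of them. *)
pose k : R := \sum_(l : link) (2 * normal_peak (sd l)).
pose m : R := \prod_(l : link) Num.min 1 (2 * normal_pdf 0 (sd l) 1).
have pk l : 0 < 2 * normal_peak (sd l).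
  by rewrite mulr_gt0// normal_peak_gt0// gt_eqF// sd_gt0.
have pm l : 0 < Num.min 1 (2 * normal_pdf 0 (sd l) 1).
  by rewrite lt_min ltr01 mulr_gt0// normal_pdf_gt0// sd_gt0.
have k_ge l : 2 * normal_peak (sd l) <= k.
  by rewrite /k (bigD1 l)//= lerDl sumr_ge0// => i _; exact: ltW.
have k_gt0 : 0 < k := lt_le_trans (pk lSD) (k_ge lSD).
have m_gt0 : 0 < m by exact: prodr_gt0.
have m_le l : m <= 2 * normal_pdf 0 (sd l) 1.
  apply: (@le_trans _ _ (Num.min 1 (2 * normal_pdf 0 (sd l) 1))); last first.
    by rewrite ge_min lexx orbT.
  rewrite /m (bigD1 l)//=; apply: ler_piMr; first exact: ltW.
  apply: prodr_ile1 => i _; apply/andP; split; first exact: ltW.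
  by rewrite ge_min lexx.
exists (m ^+ 2), (k ^+ 2); split; rewrite ?exprn_gt0// => J y y0.
have fin l : normal_prob 0 (sd l) (`](- y), y[%classic : set R) \is a fin_num.
  by rewrite fin_num_measure.
have bp0 l : 0 <= ballp y l by rewrite fine_ge0.
rewrite probability_box -!exprMn -!prodr_const; split=> [|y1];
  apply: ler_prod => l _.
  rewrite sqr_ge0 /=; apply: lerXn2r; rewrite ?nnegrE//.
    exact/ltW/mulr_gt0.
  rewrite -lee_fin fineK; last exact: fin.
  apply: le_trans (normal_prob_ball_le _ (sd_gt0 l) _ y0) _.
  by rewrite lee_fin; apply: ler_wpM2r; [exact: ltW|exact: k_ge].
rewrite sqr_ge0 /=; apply: lerXn2r; rewrite ?nnegrE//.
  exact/ltW/mulr_gt0.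
rewrite -lee_fin fineK; last exact: fin.
apply: le_trans (normal_prob_ball_ge _ (sd_gt0 l) _ _); last by rewrite y0.
by rewrite lee_fin; apply: ler_wpM2r; [exact: ltW|exact: m_le].
Qed.

End gain_boxes.

(** * Outage probability *)

Section outage_bounds.
Context {R : realType} {d : measure_display} {T : measurableType d}.
Variables (P : probability T R) (re im : link -> T -> R) (sigma2 : link -> R).
Hypothesis gains : cscg_independent_gains P re im sigma2.
Hypothesis sigma2_gt0 : forall l, 0 < sigma2 l.
Variables (s : R -> R) (tau Ts r : R).
Hypotheses (Ts_gt0 : 0 < Ts) (sW : waveform s Ts 2) (tau_itv : 0 < tau < Ts).
Variables (c C : R).
Hypotheses (c_gt0 : 0 < c) (C_gt0 : 0 < C).
Hypothesis bounds : forall w, w \in `[- pi, pi] ->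
  [/\ c <= complex.Re (Ttilde11 s tau Ts w),
      complex.Re (Ttilde11 s tau Ts w) <= C &
      c ^+ 2 <= complex.Re (detTtilde s tau Ts w)].
Implicit Types (snr y : R) (l : link) (x : T).

Local Notation gain := (gain2 re im).
Local Notation box := (box re im).

Lemma gain2_ge0 l x : 0 <= gain l x.
Proof. by rewrite addr_ge0 ?sqr_ge0. Qed.

Lemma measurable_gain2 l : measurable_fun setT (gain l).
Proof.
by case: gains => mre mim _ _ _; apply: measurable_funD; exact: measurable_funX.
Qed.

Let gain2_lt l x y : 0 <= y -> gain l x < y ^+ 2 ->
  `|re l x| < y /\ `|im l x| < y.
Proof.
move=> y0 gy; split; rewrite -ltr_sqr ?nnegrE// real_normK ?num_real//;
  apply: le_lt_trans gy; rewrite /gain2.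
  by rewrite lerDl sqr_ge0.
by rewrite lerDr sqr_ge0.
Qed.

Let lt_gain2 l x y : `|re l x| < y /\ `|im l x| < y -> gain l x < 2 * y ^+ 2.
Proof.
move=> [h1 h2]; have y0 : 0 <= y := ltW (le_lt_trans (normr_ge0 _) h1).
rewrite (_ : 2 * _ = y ^+ 2 + y ^+ 2); last by ring.
by apply: ltrD; rewrite -real_normK ?num_real// ltr_sqr ?nnegrE.
Qed.

(* [rate_gain snr = 2 ^ (2 * rate)] *)
Definition rate_gain snr : R := expR (2 * r * ln (1 + snr * sigma2 lSD)).

Local Notation rt snr := (rate r snr (sigma2 lSD)).
Local Notation K := rate_gain.

Let rate_gain_gt0 snr : 0 < K snr. Proof. exact: expR_gt0. Qed.

Let log2_lt_rate snr (z : R) : 0 < z -> (log2 z < 2 * rt snr) = (z < K snr).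
Proof.
move=> z0; rewrite /rate /log2 !mulrA ltr_pM2r ?invr_gt0 ?ln2_gt0//.
by rewrite /rate_gain -[in RHS](lnK z0) ltr_expR.
Qed.

Let one_rho snr l x (k : R) : 0 < snr -> 0 < k -> 1 <= 1 + rho0 snr * gain l x * k.
Proof.
move=> snr0 k0; rewrite lerDl; apply: mulr_ge0; last exact: ltW.
by apply: mulr_ge0; [exact/ltW/rho0_gt0|exact: gain2_ge0].
Qed.

Let one_rho_gt0 snr l x (k : R) : 0 < snr -> 0 < k ->
  0 < 1 + rho0 snr * gain l x * k.
Proof. by move=> snr0 k0; exact: lt_le_trans (one_rho _ _ _ _ snr0 k0). Qed.

(** The factor [1] stands where [c] or [C] stands for the links to the destination, so that relay
    decoding obeys the same threshold lemmas. *)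
Let decodesE snr l x : 0 < snr ->
  decodes snr (rt snr) (gain l x) = (K snr <= 1 + rho0 snr * gain l x * 1).
Proof.
move=> snr0; rewrite leNgt -log2_lt_rate; last exact: one_rho_gt0.
rewrite -leNgt /decodes mulr1; apply/idP/idP; lra.
Qed.

Let Out snr : set T :=
  [set x | I_Astc re im s tau Ts snr (rt snr) x < rt snr].

Let measurable_Out snr : 0 < snr -> measurable (Out snr).
Proof.
move=> snr0.
have mESD l : measurable_fun setT (fun x => I_ESD s tau Ts snr (gain l x)).
  apply: (measurable_I_ESD _ _ _ Ts_gt0 sW tau_itv c C c_gt0) => //.
    exact: measurable_gain2.
  by move=> x; exact: gain2_ge0.
have mMac : measurable_fun setT
    (fun x => I_EMacA s tau Ts snr (gain lR1D x) (gain lR2D x)).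
  apply: (measurable_I_EMacA _ _ _ Ts_gt0 sW tau_itv c C c_gt0) => //;
    by [exact: measurable_gain2|move=> x; exact: gain2_ge0].
have mdec l : measurable_fun setT (fun x => decodes snr (rt snr) (gain l x)).
  apply: measurable_fun_ler => //; apply: measurable_funM => //.
  apply: measurableT_comp; first exact: measurable_log2.
  apply: measurable_funD => //; apply: measurable_funM => //.
  exact: measurable_gain2.
have mI : measurable_fun setT (I_Astc re im s tau Ts snr (rt snr)).
  apply: measurable_fun_ifT; first exact: measurable_and.
    by apply: measurable_funD; exact: measurable_funM.
  apply: measurable_fun_ifT => //.
    by apply: measurable_funD; exact: measurable_funM.
  apply: measurable_fun_ifT => //; last exact: measurable_funM.
  by apply: measurable_funD; exact: measurable_funM.
rewrite /Out (_ : [set x | _] =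
  setT `&` I_Astc re im s tau Ts snr (rt snr) @^-1` `]-oo, rt snr[).
  exact: mI.
by rewrite setTI; apply/seteqP; split => x /=; rewrite in_itv.
Qed.

(** The value [1] accounts for the decoding tests, [c] and [C] for the mutual informations. *)
Let cmin : R := Num.min 1 c.
Let Cmax : R := Num.max 1 C.

Let cmin_gt0 : 0 < cmin. Proof. by rewrite lt_min ltr01. Qed.
Let Cmax_ge1 : 1 <= Cmax. Proof. by rewrite le_max lexx. Qed.

(** [yup] is the radius below which [1 + rho g cmin < K] forces a gain. In [ylo], the [4] pays for
    the factor 2 between square and disk and for the bound [1 + K / 2 <= K], valid when [2 <= K]. *)
Let yup snr : R := Num.sqrt (K snr / rho0 snr / cmin).
Let ylo snr : R := Num.sqrt (K snr / rho0 snr / (4 * Cmax)).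

Let Kr_gt0 snr : 0 < snr -> 0 < K snr / rho0 snr.
Proof. by move=> snr0; apply: divr_gt0 => //; exact: rho0_gt0. Qed.

Let gain_yup snr l x (k : R) : 0 < snr -> cmin <= k ->
  1 + rho0 snr * gain l x * k < K snr ->
  `|re l x| < yup snr /\ `|im l x| < yup snr.
Proof.
move=> snr0 ck h; apply: gain2_lt; first exact: sqrtr_ge0.
have rho_gt0 : 0 < rho0 snr by exact: rho0_gt0.
rewrite sqr_sqrtr; last by apply/ltW/divr_gt0 => //; exact: Kr_gt0.
rewrite ltr_pdivlMr// ltr_pdivlMr//.
have : gain l x * rho0 snr * cmin <= gain l x * rho0 snr * k.
  by apply: ler_wpM2l => //; apply: mulr_ge0; [exact: gain2_ge0|exact: ltW].
by move: h; rewrite mulrAC (mulrC (rho0 snr)); lra.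
Qed.

(** The links that must be weak when the decoding set is empty, [{R1}], [{R2}] and [{R1, R2}], in
    this order. *)
Let J0 : {set link} := [set lSR1; lSR2; lSD]%SET.
Let J1 : {set link} := [set lSR2; lSD; lR1D]%SET.
Let J2 : {set link} := [set lSR1; lSD; lR2D]%SET.
Let J3 : {set link} := [set lSD; lR1D; lR2D]%SET.

Let in3 (l1 l2 l3 : link) y x :
  `|re l1 x| < y /\ `|im l1 x| < y -> `|re l2 x| < y /\ `|im l2 x| < y ->
  `|re l3 x| < y /\ `|im l3 x| < y -> box [set l1; l2; l3]%SET y x.
Proof.
by move=> h1 h2 h3 l; rewrite !inE => /orP[/orP[]|] /eqP ->.
Qed.

(* In each of the four decoding scenarios an outage forces three independent
   gains to be below [K / rho], up to a constant factor. *)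
Let Out_sub snr : 0 < snr ->
  Out snr `<=` (box J0 (yup snr) `|` box J1 (yup snr)) `|`
               (box J2 (yup snr) `|` box J3 (yup snr)).
Proof.
move=> snr0 x; rewrite /Out /I_Astc /= !decodesE//.
have cmin1 : cmin <= 1 by rewrite ge_min lexx.
have cminc : cmin <= c by rewrite ge_min lexx orbT.
have ESD_ge l : log2 (1 + rho0 snr * gain l x * c) <= I_ESD s tau Ts snr (gain l x).
  by apply: (I_ESD_ge _ _ _ Ts_gt0 sW tau_itv c C) => //; exact: gain2_ge0.
have log_ge0 l : 0 <= log2 (1 + rho0 snr * gain l x * c).
  by apply: log2_ge0; exact: one_rho.
have small l : log2 (1 + rho0 snr * gain l x * c) < 2 * rt snr ->
    `|re l x| < yup snr /\ `|im l x| < yup snr.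
  rewrite log2_lt_rate; last exact: one_rho_gt0.
  exact: gain_yup.
have small1 l : (K snr <= 1 + rho0 snr * gain l x * 1) = false ->
    `|re l x| < yup snr /\ `|im l x| < yup snr.
  by move/negbT; rewrite -ltNge; exact: gain_yup.
have Mac_ge : log2 (1 + rho0 snr * gain lR1D x * c) <=
      I_EMacA s tau Ts snr (gain lR1D x) (gain lR2D x) /\
    log2 (1 + rho0 snr * gain lR2D x * c) <=
      I_EMacA s tau Ts snr (gain lR1D x) (gain lR2D x).
  have := I_EMacA_ge _ _ _ Ts_gt0 sW tau_itv c C c_gt0 bounds _ snr0 _ _
    (gain2_ge0 lR1D x) (gain2_ge0 lR2D x).
  (* Both factors of the product are at least [1], so it dominates each of them. *)
  move=> Mac; split; apply: le_trans Mac; apply: ler_log2; try exact: one_rho_gt0.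
    by apply: ler_peMr; [exact/ltW/one_rho_gt0|exact: one_rho].
  by apply: ler_peMl; [exact/ltW/one_rho_gt0|exact: one_rho].
(* All terms are nonnegative, so a sum below [2 * rate] keeps each term below it; [lra] concludes in
   every case. *)
have := (ESD_ge lSD, ESD_ge lR1D, ESD_ge lR2D, log_ge0 lSD, log_ge0 lR1D, log_ge0 lR2D).
move=> [[[[[e1 e2] e3] e4] e5] e6]; move: Mac_ge => [e7 e8].
case D1 : (K snr <= 1 + rho0 snr * gain lSR1 x * 1);
  case D2 : (K snr <= 1 + rho0 snr * gain lSR2 x * 1) => /= h.
- by right; right; apply: in3; apply: small; lra.
- by left; right; apply: in3; [exact: small1|apply: small; lra..].
- by right; left; apply: in3; [exact: small1|apply: small; lra..].
- by left; left; apply: in3; [exact: small1|exact: small1|apply: small; lra].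
Qed.

Let sub_Out snr : 0 < snr -> 2 <= K snr -> box J0 (ylo snr) `<=` Out snr.
Proof.
move=> snr0 K2 x bx.
have rho_gt0 : 0 < rho0 snr by exact: rho0_gt0.
have Cmax_gt0 : 0 < Cmax by exact: lt_le_trans Cmax_ge1.
have lt_K l (k : R) : l \in J0 -> 0 < k -> k <= Cmax ->
    1 + rho0 snr * gain l x * k < K snr.
  move=> /bx/lt_gain2 + k0 kC.
  rewrite sqr_sqrtr; last by apply/ltW/divr_gt0; [exact: Kr_gt0|exact: mulr_gt0].
  rewrite (_ : 2 * _ = K snr / 2 / (rho0 snr * Cmax)); last first.
    by field; rewrite !gt_eqF.
  rewrite ltr_pdivlMr ?mulr_gt0// => h.
  have : rho0 snr * gain l x * k <= rho0 snr * gain l x * Cmax.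
    by apply: ler_wpM2l => //; apply: mulr_ge0; [exact: ltW|exact: gain2_ge0].
  by move: h; rewrite mulrA (mulrC _ (rho0 snr)); lra.
have C1 : C <= Cmax by rewrite le_max lexx orbT.
rewrite /Out /I_Astc /= !decodesE// !leNgt !lt_K ?inE ?eqxx ?orbT//=.
(* No relay decodes, so only half the direct information is left, and it misses the rate. *)
have : log2 (1 + rho0 snr * gain lSD x * C) < 2 * rt snr.
  rewrite log2_lt_rate; last exact: one_rho_gt0.
  by apply: lt_K => //; rewrite !inE eqxx orbT.
have := I_ESD_le _ _ _ Ts_gt0 sW tau_itv c C c_gt0 bounds _ snr0 _ (gain2_ge0 lSD x).
lra.
Qed.

Lemma outage_bounds : exists a b : R, [/\ 0 < a, 0 < b & forall snr, 0 < snr ->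
  outage P re im sigma2 s tau Ts r snr <= b * (rate_gain snr / rho0 snr) ^+ 3 /\
  (2 <= rate_gain snr -> rate_gain snr / rho0 snr <= 1 ->
   a * (rate_gain snr / rho0 snr) ^+ 3 <= outage P re im sigma2 s tau Ts r snr)].
Proof.
have [a [b [a0 b0 boxP]]] := box_bounds _ _ _ _ gains sigma2_gt0.
have Cmax_gt0 : 0 < Cmax by exact: lt_le_trans Cmax_ge1.
(* The leading [4] of the upper constant counts the boxes in the union bound; the other factors come
   from [ylo] and [yup], squared. *)
exists ((a / (4 * Cmax)) ^+ 3), (4 * (b / cmin) ^+ 3); split.
- by rewrite exprn_gt0// divr_gt0// mulr_gt0.
- by rewrite mulr_gt0// exprn_gt0// divr_gt0.
move=> snr snr0; have Kr0 := Kr_gt0 _ snr0.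
have yup0 : 0 < yup snr by rewrite sqrtr_gt0 divr_gt0.
have ylo0 : 0 < ylo snr by rewrite sqrtr_gt0 divr_gt0// mulr_gt0.
have mbox (J : {set link}) y : measurable (box J y) := measurable_box _ _ _ _ gains J y.
have finP (A : set T) : measurable A -> P A \is a fin_num.
  by move=> mA; exact: fin_num_measure.
have card3 (l1 l2 l3 : link) : [&& l1 != l2, l1 != l3 & l2 != l3] ->
    #|([set l1; l2; l3]%SET : {set link})| = 3%N.
  move=> /and3P[h12 h13 h23].
  by rewrite -finset.setUA cardsU1 cards2 !inE negb_or h12 h13 h23.
have divMA (u v z : R) : u / v * z = u * (z / v) by rewrite mulrAC mulrA.
rewrite /outage -/(Out snr); split.
  have boxle (J : {set link}) : #|J| = 3%N ->
      (P (box J (yup snr)) <= ((b / cmin) ^+ 3 * (K snr / rho0 snr) ^+ 3)%:E)%E.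
    move=> J3c; rewrite -[X in (X <= _)%E]fineK ?finP// lee_fin.
    have [+ _] := boxP J _ yup0; rewrite J3c => /le_trans; apply.
    rewrite sqr_sqrtr; last exact/ltW/divr_gt0.
    by rewrite -exprMn (divMA b).
  rewrite -lee_fin fineK; last exact/finP/measurable_Out.
  apply: (@le_trans _ _ (P ((box J0 (yup snr) `|` box J1 (yup snr)) `|`
               (box J2 (yup snr) `|` box J3 (yup snr))))).
    apply: le_measure; rewrite ?inE; [exact: measurable_Out| |exact: Out_sub].
    by do 2? apply: measurableU.
  apply: (@le_trans _ _ ((P (box J0 (yup snr)) + P (box J1 (yup snr))) +
               (P (box J2 (yup snr)) + P (box J3 (yup snr))))%E).
    have PU (A B : set T) : measurable A -> measurable B ->
      (P (A `|` B) <= P A + P B)%E by move=> mA mB; exact: measureU2.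
    apply: le_trans (PU _ _ _ _) _; try by apply: measurableU.
    by apply: leeD; exact: PU.
  rewrite (_ : 4 * _ * _ = let z := (b / cmin) ^+ 3 * (K snr / rho0 snr) ^+ 3 in
    (z + z) + (z + z)); last by rewrite /=; ring.
  by rewrite /= !EFinD; apply: leeD; apply: leeD; apply: boxle; exact: card3.
move=> K2 Kr1.
(* The lower density bound applies only to half-sides at most [1]. *)
have ylo1 : ylo snr <= 1.
  rewrite -sqrtr1; apply: ler_wsqrtr; rewrite ler_pdivrMr ?mulr_gt0// mul1r.
  by apply: le_trans Kr1 _; have := Cmax_ge1; lra.
have [_ /(_ ylo1)] := boxP J0 _ ylo0; rewrite card3// => h.
apply: (@le_trans _ _ (fine (P (box J0 (ylo snr))))).
  apply: le_trans h; rewrite sqr_sqrtr; last by rewrite ltW// divr_gt0// mulr_gt0.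
  by rewrite -exprMn (divMA a).
apply: fine_le; rewrite ?finP//; first exact: measurable_Out.
by apply: le_measure; rewrite ?inE; [exact: mbox|exact: measurable_Out|exact: sub_Out].
Qed.

End outage_bounds.

(** * From power-law bounds to the exponent *)

Lemma near_pinfty_ln (R : realType) (A : R) : \forall x \near +oo, A <= ln x.
Proof.
have : \forall x \near +oo, expR A <= x by apply: nbhs_pinfty_ge; exact: num_real.
apply: filterS => x Ax; rewrite -[leLHS]expRK ler_ln ?posrE ?expR_gt0//.
exact: lt_le_trans (expR_gt0 _) Ax.
Qed.

(** The distance to [e] is a bounded quantity divided by [ln x], which tends to infinity. *)
Lemma cvg_ln_exponent (R : realType) (f : R -> R) (e m M : R) :
  (\forall x \near +oo, m <= ln (f x) + e * ln x <= M) ->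
  - ln (f x) / ln x @[x --> +oo] --> e.
Proof.
move=> fmM; apply/cvgrPdist_le => eps eps0.
pose D := `|m| + `|M|.
have h1 := near_pinfty_ln R 1; have h2 := near_pinfty_ln R (D / eps).
move: fmM h1 h2; apply: filterS3 => x /andP[mf fM] L1 LD.
have L0 : 0 < ln x by lra.
rewrite (_ : e - _ = (ln (f x) + e * ln x) / ln x); last first.
  by field; rewrite gt_eqF.
rewrite normrM normfV (ger0_norm (ltW L0)) ler_pdivrMr//.
apply: (@le_trans _ _ D); last by move: LD; rewrite ler_pdivrMr// mulrC.
have := normr_ge0 m; have := normr_ge0 M; have := ler_norm M.
have := ler_norm (- m); rewrite normrN ler_norml /D => *; apply/andP; split; lra.
Qed.

Theorem theorem9 (R : realType) (d : measure_display) (T : measurableType d)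
    (P : probability T R) (re im : link -> T -> R) (sigma2 : link -> R)
    (s : R -> R) (Ts tau r : R) :
  cscg_independent_gains P re im sigma2 ->
  (forall l, 0 < sigma2 l) ->
  0 < Ts ->
  waveform s Ts 2 ->
  0 < tau < Ts ->
  lin_indep_condition s tau Ts 2 ->
  0 < r < 2^-1 ->
  - ln (outage P re im sigma2 s tau Ts r snr) / ln snr @[snr --> +oo]
    --> 3 * (1 - 2 * r).
Proof.
move=> gains sigma2_gt0 Ts_gt0 sW tau_itv indep /andP[r_gt0 r_lt].
have [c [C [c_gt0 C_gt0 bounds]]] := spectrum_bounds _ _ _ Ts_gt0 sW tau_itv indep.
have [a [b [a_gt0 b_gt0 outageP]]] := outage_bounds _ _ _ _ gains sigma2_gt0
  _ _ _ r Ts_gt0 sW tau_itv _ _ c_gt0 C_gt0 bounds.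
pose sg := sigma2 lSD; have sg_gt0 : 0 < sg := sigma2_gt0 lSD.
(* Bounds for [ln q + (1 - 2 r) ln snr], where [q = K / rho]: for [snr >= 1], [1 + snr * sg] lies
   between [snr * sg] and [snr * (1 + sg)], and [ln (2 / 3)] comes from [rho0]. *)
pose m := 2 * r * ln sg - ln (2 / 3); pose M := 2 * r * ln (1 + sg) - ln (2 / 3).
apply: (@cvg_ln_exponent _ _ _ (ln a + 3 * m) (ln b + 3 * M)).
(* The first threshold makes [rate_gain] at least [2]; the second, where [r < 1/2] enters, makes [q]
   at most [1]. *)
have n2 := near_pinfty_ln R (ln 2 / (2 * r) - ln sg).
have n3 := near_pinfty_ln R (M / (1 - 2 * r)).
have n0 : \forall x \near +oo, (1 : R) <= x by apply: nbhs_pinfty_ge; exact: num_real.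
near=> snr.
have snr1 : 1 <= snr by near: snr.
have L2 : ln 2 / (2 * r) - ln sg <= ln snr by near: snr.
have L3 : M / (1 - 2 * r) <= ln snr by near: snr.
have snr_gt0 : 0 < snr by lra.
have rho_gt0 : 0 < rho0 snr by exact: rho0_gt0.
have arg_gt0 : 0 < 1 + snr * sg by rewrite addr_gt0// mulr_gt0.
have lo : ln sg + ln snr <= ln (1 + snr * sg).
  rewrite -lnM ?posrE// ler_ln ?posrE ?mulr_gt0//; lra.
have hi : ln (1 + snr * sg) <= ln (1 + sg) + ln snr.
  rewrite -lnM ?posrE ?addr_gt0// ler_ln ?posrE ?mulr_gt0 ?addr_gt0//; nra.
pose q := rate_gain sigma2 r snr / rho0 snr.
have K_gt0 : 0 < rate_gain sigma2 r snr by exact: expR_gt0.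
have q_gt0 : 0 < q by exact: divr_gt0.
have lnq : ln q = 2 * r * ln (1 + snr * sg) - ln (2 / 3) - ln snr.
  rewrite ln_div ?posrE// /rate_gain expRK /rho0 lnM ?posrE//; lra.
have r2_gt0 : 0 < 2 * r by rewrite mulr_gt0.
have mq : m <= ln q + (1 - 2 * r) * ln snr.
  rewrite lnq /m; move: lo; rewrite -(ler_pM2l r2_gt0); lra.
have qM : ln q + (1 - 2 * r) * ln snr <= M.
  rewrite lnq /M; move: hi; rewrite -(ler_pM2l r2_gt0); lra.
have [up low] := outageP _ snr_gt0.
have K2 : 2 <= rate_gain sigma2 r snr.
  rewrite -[leLHS]lnK ?posrE// ler_expR.
  move: L2; rewrite lerBlDr ler_pdivrMr// => L2.
  move: lo; rewrite -(ler_pM2l r2_gt0); lra.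
have q1 : q <= 1.
  rewrite -ler_ln ?posrE// ln1.
  have r1 : 0 < 1 - 2 * r by lra.
  move: L3; rewrite ler_pdivrMr//; lra.
have {}low := low K2 q1; rewrite -/q in up low.
(* Positivity of the outage probability is needed before comparing logarithms, since [ln] is [0] on
   nonpositive numbers. *)
have a3 : 0 < a * q ^+ 3 by rewrite mulr_gt0// exprn_gt0.
have o_gt0 := lt_le_trans a3 low.
have lnMq z : 0 < z -> ln (z * q ^+ 3) = ln z + 3 * ln q.
  by move=> z0; rewrite lnM ?posrE ?exprn_gt0// lnXn// mulr_natl.
have up_gt0 := lt_le_trans o_gt0 up.
move: low up; rewrite -(ler_ln a3 o_gt0) -(ler_ln o_gt0 up_gt0) !lnMq// => low up.
by apply/andP; split; lra.
Unshelve. all: by end_near. Qed.
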